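(* For each dimension $d\geq 2$ there exist numbers $f'(d)$ and $g'(d)$ with the following property. Let $\mathcal{F}$ be a finite $d$-colored family of convex sets in $\mathbb{R}^d$, with color classes $\mathcal{F}_1,\dots,\mathcal{F}_d$, that satisfies $\mathcal{CH}(\mathcal{F}_1,\dots,\mathcal{F}_d)$. Then one of the following holds: (1) there is a color class $\mathcal{F}_j$, $j\in[d]$, that can be pierced by $f'(d)$ points; or (2) the entire family $\mathcal{F}$ can be crossed by $g'(d)$ lines.
   Context: A finite family $\mathcal{F}$ of convex sets is $k$-colored if each set is colored with (at least) one of $k$ colors; $\mathcal{F}=\mathcal{F}_1\cup\dots\cup\mathcal{F}_k$, where $\mathcal{F}_i$ is the class of sets with color $i$. The family has the Colorful Helly property $\mathcal{CH}(\mathcal{F}_1,\dots,\mathcal{F}_k)$ if every rainbow selection $K_i\in\mathcal{F}_i$, $1\le i\le k$, satisfies $\bigcap_{i=1}^k K_i\neq\emptyset$. A collection $X$ of points (resp. lines) pierces/crosses a family if every set of the family is intersected by some member of $X$. *)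

(* Defs.v *)
(* Points of R^d are row vectors in 'rV[R]_d. *)
From HB Require Import structures.
From mathcomp Require Import all_boot all_order all_algebra.
From mathcomp Require Import all_classical all_reals all_analysis.

Set Implicit Arguments.
Unset Strict Implicit.
Unset Printing Implicit Defensive.

Import Order.TTheory GRing.Theory Num.Theory.

Local Open Scope classical_set_scope.
Local Open Scope card_scope.
Local Open Scope ring_scope.

Section ColorfulHelly.
Context {R : realType} {d : nat}.
Implicit Types (F : set (set 'rV[R]_d)) (X l : set 'rV[R]_d).

(* The colour classes may overlap and may be empty. *)
Definition colored_by (k : nat) F (C : 'I_k -> set (set 'rV[R]_d)) : Prop :=
  F = \bigcup_(i : 'I_k) C i.

Definition colorful_Helly (k : nat) (C : 'I_k -> set (set 'rV[R]_d)) : Prop :=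
  forall K : 'I_k -> set 'rV[R]_d,
    (forall i, C i (K i)) -> \bigcap_(i : 'I_k) K i !=set0.

Definition is_line l : Prop :=
  exists p v : 'rV[R]_d, v != 0 /\ l = [set p + t *: v | t in [set: R]].

(* As usual, "by n points" and "by n lines" mean "by at most n"
   (A #<= `I_n says that A has at most n elements). *)
Definition pierced_by_points (n : nat) F : Prop :=
  exists X, X #<= `I_n /\ forall K, F K -> X `&` K !=set0.

Definition crossed_by_lines (n : nat) F : Prop :=
  exists L : set (set 'rV[R]_d),
    [/\ L #<= `I_n,
        forall l, L l -> is_line l
      & forall K, F K -> exists2 l, L l & l `&` K !=set0].

End ColorfulHelly.

(* Main.v *)
(* Fix a colour class i. The other d - 1 classes may be assumed not pierceable
   by few points. Going through them one at a time, one builds boundedly many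
   flats, of dimension at most d - k after k classes, such that every convex set
   meeting all the rainbow intersections of these k classes crosses one of the
   flats; after d - 1 classes the flats are lines, and they cross class i.

   For the next class, suppose g flats are available. By the Alon-Kleitman (p,q)
   argument the class contains a sample of bounded size that cannot be pierced
   by g points. Given K, each sample set S is coloured by a flat that meets K
   inside S; some colour class J has no common point inside its flat E. Compact
   convex sets in E without a common point lie in closed half-spaces of E
   without a common point, so K, which meets all of them inside E, crosses one
   of the bounding hyperplanes of E. These depend only on (E, J).

   The (p,q) argument combines fractional Helly, multiplicative weights (in place
   of linear programming duality) and weak epsilon-nets. *)
Require Import Defs.
From HB Require Import structures.
From mathcomp Require Import all_boot all_order all_algebra perm.
From mathcomp Require Import all_classical all_reals all_analysis.
From mathcomp Require Import ring lra zify.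

Set Implicit Arguments.
Unset Strict Implicit.
Unset Printing Implicit Defensive.

Import Order.TTheory GRing.Theory Num.Theory.
Import numFieldNormedType.Exports.

Local Open Scope classical_set_scope.
Local Open Scope ring_scope.

(** * Convex sets and convex combinations *)

Section Convexity.
Context {R : realType} {V : lmodType R}.
Implicit Types A B : set V.

Lemma convex_setP A : convex_set A <->
  forall x y t, 0 <= t -> t <= 1 -> A x -> A y -> A (t *: x + (1 - t) *: y).
Proof.
split=> [cA x y t t0 t1 Ax Ay|cA x y l /set_mem Ax /set_mem Ay].
  have t01 : Itv.spec (@Itv.num_sem R) (Itv.Real `[0%Z, 1%Z]) t.
    by apply/and3P; split; rewrite ?ger0_real //= in_itv /= t0.
  have := cA x y (Itv.mk t01) (mem_set Ax) (mem_set Ay).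
  by move/set_mem.
apply/mem_set; exact: cA (ge0 l) (le1 l) Ax Ay.
Qed.

Lemma convex_setI A B : convex_set A -> convex_set B -> convex_set (A `&` B).
Proof.
move=> /convex_setP cA /convex_setP cB; apply/convex_setP => x y t t0 t1.
by move=> [Ax Bx] [Ay By]; split; [apply: cA|apply: cB].
Qed.

Lemma convex_set_bigcap (I : Type) (P : set I) (F : I -> set V) :
  (forall i, P i -> convex_set (F i)) -> convex_set (\bigcap_(i in P) F i).
Proof.
move=> cF; apply/convex_setP => x y t t0 t1 Fx Fy i Pi.
by have /convex_setP := cF i Pi; apply => //; [apply: Fx|apply: Fy].
Qed.

Lemma convex_comb (I : finType) (w : I -> R) (p : I -> V) A :
  convex_set A -> (forall i, 0 <= w i) -> \sum_i w i = 1 ->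
  (forall i, 0 < w i -> A (p i)) -> A (\sum_i w i *: p i).
Proof.
move=> /convex_setP cA w0 w1 Ap.
(* Partial sums of weights do not add up to 1, so the induction runs over normalised partial sums of
   positive total weight. *)
suff H (s : seq I) : 0 < \sum_(i <- s) w i ->
    A ((\sum_(i <- s) w i)^-1 *: \sum_(i <- s) w i *: p i).
  by have := H (index_enum I); rewrite w1 invr1 scale1r; apply.
elim: s => [|i s IHs]; first by rewrite big_nil ltxx.
rewrite !big_cons; set W := \sum_(j <- s) w j in IHs *.
set P := \sum_(j <- s) _ in IHs *.
have W0 : 0 <= W by rewrite sumr_ge0.
have := w0 i; rewrite le_eqVlt => /predU1P[<-|wi]; first by rewrite scale0r !add0r.
move: W0; rewrite le_eqVlt => /predU1P[W0 _|W0 _].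
  suff -> : P = 0.
    by rewrite -W0 !addr0 scalerA mulVf ?gt_eqF// scale1r; apply: Ap.
  rewrite /P big_seq big1 // => j js.
  have /eqP : \sum_(j <- s) w j = 0 by rewrite -/W -W0.
  rewrite psumr_eq0 // => /allP /(_ _ js) /= /eqP ->.
  by rewrite scale0r.
have WW : 0 < w i + W by rewrite addr_gt0.
have -> : (w i + W)^-1 *: (w i *: p i + P) =
   (w i / (w i + W)) *: p i + (1 - w i / (w i + W)) *: (W^-1 *: P).
  rewrite scalerDr !scalerA; congr (_ *: _ + _ *: _); first by rewrite mulrC.
  by field; rewrite !gt_eqF.
apply: cA; rewrite ?divr_ge0 ?(ltW wi) ?(ltW WW) //.
- by rewrite ler_pdivrMr // mul1r lerDl ltW.
- exact: Ap.
- exact: IHs.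
Qed.

End Convexity.

(** * Radon's theorem, and Helly's theorem for [d + 2] sets *)

Section Radon.
Context {R : realType} {d : nat}.

(** Prefixing each point with a coordinate 1 gives [d + 2] rows of length [d + 1], hence a nonzero
    vector in the left kernel. *)
Lemma affine_dependence (p : 'I_d.+2 -> 'rV[R]_d) :
  exists l : 'I_d.+2 -> R,
    [/\ exists i, l i != 0, \sum_i l i = 0 & \sum_i l i *: p i = 0].
Proof.
pose M : 'M[R]_(d.+2, 1 + d) := row_mx (const_mx 1) (\matrix_i p i).
have kM : kermx M != 0.
  rewrite -mxrank_eq0 mxrank_ker subn_eq0 -ltnNge.
  by apply: leq_ltn_trans (rank_leq_col M) _.
have : nz_row (kermx M) *m M = 0.
  by apply/eqP; rewrite -sub_kermx nz_row_sub.
move: kM; rewrite -nz_row_eq0; set u := nz_row _ => u0.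
rewrite mul_mx_row -[X in _ = X](@row_mx0 R 1 1 d) => /eq_row_mx[u1 up].
exists (fun i => u 0 i); split.
- by move/rV0Pn: u0.
- have := congr1 (fun M : 'M[R]_(1, 1) => M 0 0) u1; rewrite !mxE => u10.
  by rewrite -[RHS]u10; apply: eq_bigr => i _; rewrite !mxE mulr1.
- rewrite -[RHS]up mulmx_sum_row; apply: eq_bigr => i _.
  by rewrite rowK.
Qed.

(** [S] collects the positive coefficients of an affine dependence. Moving the other terms across
    and dividing by the positive sum [L] writes one point [z] as a convex combination of either
    part. *)
Lemma radon (p : 'I_d.+2 -> 'rV[R]_d) :
  exists (S : 'I_d.+2 -> bool) z, forall (b : bool) (A : set 'rV[R]_d),
    convex_set A -> (forall i, S i = b -> A (p i)) -> A z.
Proof.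
have [l [[i0 li0] l0 lp]] := affine_dependence p.
pose S i := 0 < l i; pose L := \sum_(i | S i) l i.
have L0 : 0 < L.
  rewrite lt_def sumr_ge0 ?andbT => [|i /ltW //].
  apply: contra_neq li0 => L0.
  have LN : \sum_(i | ~~ S i) - l i = 0.
    rewrite sumrN; apply/eqP; rewrite oppr_eq0; apply/eqP.
    by move: l0; rewrite (bigID S) /= -/L L0 add0r.
  case: (boolP (S i0)) => Si0.
    by have /eqP := L0; rewrite psumr_eq0 => [/allP/(_ i0)|i /ltW //];
      rewrite mem_index_enum Si0 => /(_ isT) /eqP.
  have /eqP := LN; rewrite psumr_eq0 => [/allP/(_ i0)|i]; last first.
    by rewrite /S -leNgt oppr_ge0.
  by rewrite mem_index_enum Si0 oppr_eq0 => /(_ isT) /eqP.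
exists S, (\sum_i (if S i then l i / L else 0) *: p i) => -[] A cA Ap.
  apply: convex_comb => // [i||i].
  - by case: ifP => // Si; rewrite divr_ge0 // ltW.
  - by rewrite -big_mkcond -mulr_suml divff // gt_eqF.
  - by case: ifP => [Si _|]; [apply: Ap|rewrite ltxx].
have -> : \sum_i (if S i then l i / L else 0) *: p i =
          \sum_i (if S i then 0 else - l i / L) *: p i.
  apply/eqP; rewrite -subr_eq0 -sumrB.
  under eq_bigr do rewrite -scalerBl.
  rewrite (eq_bigr (fun i => L^-1 *: (l i *: p i))) => [|i _].
    by rewrite -scaler_sumr lp scaler0.
  rewrite scalerA; congr (_ *: _).
  by case: ifP => _; rewrite ?subr0 ?sub0r ?mulNr ?opprK mulrC.
apply: convex_comb => // [i||i].
- by case: ifPn => //; rewrite /S -leNgt => li; rewrite divr_ge0 ?oppr_ge0 // ltW.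
- rewrite (eq_bigr (fun i => if ~~ S i then - l i / L else 0)) => [|i _].
    rewrite -big_mkcond -mulr_suml sumrN.
    have -> : - \sum_(i | ~~ S i) l i = L.
      apply/eqP; rewrite eq_sym -subr_eq0 opprK.
      by move: l0; rewrite (bigID S) /= => ->.
    by rewrite divff // gt_eqF.
  by case: ifP.
- by case: ifP => [|Si _]; [rewrite ltxx|apply: Ap].
Qed.

(** Take [p j] in all sets but [A j]. The Radon point lies in each [A k], because [A k] contains the
    whole part that avoids the index [k]. *)
Lemma helly (A : 'I_d.+2 -> set 'rV[R]_d) :
  (forall i, convex_set (A i)) ->
  (forall j, exists x, forall k, k != j -> A k x) ->
  exists z, forall k, A k z.
Proof.
move=> cA /choice[p Ap]; have [S [z Sz]] := radon p.
exists z => k; apply: (Sz (~~ S k)) => // i Si; apply: Ap.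
by apply: contra_eqN Si => /eqP ->; case: (S i).
Qed.

End Radon.

(** * Dot product and nearest points to the origin *)

Section Norm.
Context {R : realType} {d : nat}.
Implicit Types x y u : 'rV[R]_d.

Definition dotmx x y : R := \sum_k x 0 k * y 0 k.

Lemma dotmxC x y : dotmx x y = dotmx y x.
Proof. by apply: eq_bigr => k _; rewrite mulrC. Qed.

Lemma dotmxDl x y u : dotmx (x + y) u = dotmx x u + dotmx y u.
Proof. by rewrite -big_split; apply: eq_bigr => k _; rewrite mxE mulrDl. Qed.

Lemma dotmxZl (a : R) x u : dotmx (a *: x) u = a * dotmx x u.
Proof. by rewrite mulr_sumr; apply: eq_bigr => k _; rewrite mxE mulrA. Qed.

Lemma dotmxNl x u : dotmx (- x) u = - dotmx x u.
Proof. by rewrite -scaleN1r dotmxZl mulN1r. Qed.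

Lemma dotmxDr x y u : dotmx u (x + y) = dotmx u x + dotmx u y.
Proof. by rewrite dotmxC dotmxDl !(dotmxC u). Qed.

Lemma dotmxZr (a : R) x u : dotmx u (a *: x) = a * dotmx u x.
Proof. by rewrite dotmxC dotmxZl dotmxC. Qed.

Lemma dotmxNr x u : dotmx u (- x) = - dotmx u x.
Proof. by rewrite dotmxC dotmxNl dotmxC. Qed.

Definition dotmxE := (dotmxDl, dotmxDr, dotmxZl, dotmxZr, dotmxNl, dotmxNr).

Lemma dotmx0l x : dotmx 0 x = 0.
Proof. by rewrite -[0](scale0r x) dotmxZl mul0r. Qed.

Lemma dotmx_suml (I : finType) (f : I -> 'rV[R]_d) u :
  dotmx (\sum_i f i) u = \sum_i dotmx (f i) u.
Proof.
elim/big_ind2: _ => [|x1 x2 y1 y2 <- <-|//]; first exact: dotmx0l.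
exact: dotmxDl.
Qed.

Lemma dotmx_ge0 x : 0 <= dotmx x x.
Proof. by apply: sumr_ge0 => k _; rewrite -expr2 sqr_ge0. Qed.

Lemma dotmx_eq0 x : (dotmx x x == 0) = (x == 0).
Proof.
apply/idP/eqP => [|->]; last by rewrite dotmx0l.
rewrite psumr_eq0 => [/allP x0|k _]; last by rewrite -expr2 sqr_ge0.
apply/rowP => k; rewrite mxE; apply/eqP.
by have := x0 k; rewrite mem_index_enum -expr2 sqrf_eq0 => /(_ isT).
Qed.

Lemma continuous_coord (T : topologicalType) (f : T -> 'rV[R]_d) k :
  continuous f -> continuous (fun a : T => f a 0 k).
Proof.
move=> cf a; apply: (@continuous_comp _ _ _ f (fun M : 'rV[R]_d => M 0 k)).
  exact: cf.
exact: coord_continuous.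
Qed.

Lemma continuous_dotmx (T : topologicalType) (f g : T -> 'rV[R]_d) :
  continuous f -> continuous g -> continuous (fun a : T => dotmx (f a) (g a)).
Proof.
move=> cf cg; apply: continuous_big => [|k _]; first exact: add_continuous.
by move=> a; apply: continuousM; apply: continuous_coord.
Qed.

(** The squared norm is convex: the gap in the inequality is [t * (1 - t)] times the squared
    distance from [x] to [y]. *)
Lemma convex_ball (r : R) : convex_set [set x : 'rV[R]_d | dotmx x x < r].
Proof.
apply/convex_setP => x y t t0 t1 /= xr yr.
have := dotmx_ge0 (x - y); rewrite !dotmxE (dotmxC y x) => xy0.
set a := dotmx x x in xr xy0 *; set b := dotmx y y in yr xy0 *.
set c := dotmx x y in xy0 *.
apply: (@le_lt_trans _ _ (t * a + (1 - t) * b)).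
  rewrite -subr_ge0.
  suff -> : t * a + (1 - t) * b - (t * (t * a) + t * ((1 - t) * c) +
     ((1 - t) * (t * c) + (1 - t) * ((1 - t) * b))) =
     t * (1 - t) * (a - c + (- c - - b)).
    by rewrite !mulr_ge0 ?subr_ge0 //; move: xy0; rewrite opprK; lra.
  by ring.
have [->|tn0] := eqVneq t 0; first by rewrite mul0r add0r subr0 mul1r.
have tp : 0 < t by rewrite lt_def tn0.
have : t * a < t * r by rewrite ltr_pM2l.
have : (1 - t) * b <= (1 - t) * r by rewrite ler_wpM2l ?subr_ge0 // ltW.
lra.
Qed.

Definition nearest0 (C : set 'rV[R]_d) x :=
  C x /\ forall y, C y -> dotmx x x <= dotmx y y.

(** The midpoint of two distinct nearest points would be nearer. *)
Lemma nearest0_unique C x y :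
  convex_set C -> nearest0 C x -> nearest0 C y -> x = y.
Proof.
move=> /convex_setP cC [Cx xm] [Cy ym].
have /xm : C (2^-1 *: x + (1 - 2^-1) *: y) by apply: cC => //; lra.
have := xm _ Cy; have := ym _ Cx; rewrite !dotmxE (dotmxC y x).
move=> h1 h2 h3; apply/eqP; rewrite -subr_eq0 -dotmx_eq0 eq_le dotmx_ge0 andbT.
by rewrite !dotmxE (dotmxC y x); lra.
Qed.

Lemma nearest0_exists C : compact C -> C !=set0 -> exists x, nearest0 C x.
Proof.
move=> coC C0.
have [|x /set_mem Cx xm] := @EVT_min_rV R d (fun x => dotmx x x) C C0 coC.
  by apply: continuous_subspaceT; apply: continuous_dotmx => ? .
by exists x; split => // y Cy; apply: xm; exact: mem_set.
Qed.

Lemma compact_bigcap (I : Type) (i0 : I) (A : I -> set 'rV[R]_d) :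
  (forall i, compact (A i)) -> compact (\bigcap_i A i).
Proof.
move=> coA; apply: (@subclosed_compact _ _ (A i0)) => //.
  by apply: closed_bigI => i _; apply: compact_closed => //; exact: norm_hausdorff.
by move=> x; apply.
Qed.

Definition nearest_pt (C : set 'rV[R]_d) : 'rV[R]_d := xget 0 (nearest0 C).

(* Helly's theorem for the [A k] and the open ball of points nearer to the
   origin than the nearest point of the common intersection. *)
Lemma nearest_pt_drop (A : 'I_d.+1 -> set 'rV[R]_d) :
  (forall i, convex_set (A i)) -> (forall i, compact (A i)) ->
  \bigcap_i A i !=set0 ->
  exists j, A j (nearest_pt (\bigcap_k A (lift j k))).
Proof.
move=> cA coA A0.
have [x [Ax xm]] := nearest0_exists (compact_bigcap ord0 coA) A0.
pose B (i : 'I_d.+2) : set 'rV[R]_d :=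
  if unlift ord0 i is Some k then A k else [set y | dotmx y y < dotmx x x].
have cB i : convex_set (B i).
  by rewrite /B; case: unlift => // ; exact: convex_ball.
(* Omitting the ball leaves the common point [x], yet all [d + 2] sets together have none; so
   Helly's hypothesis fails on omitting some [A j]. Then no common point of the other [A k] is
   nearer than [x]. *)
have [j Bj] : exists j : 'I_d.+1,
    ~ exists y, forall k, k != lift ord0 j -> B k y.
  apply: contrapT => /forallNP Bj.
  have [|z Bz] := helly cB.
    move=> j; case: (unliftP ord0 j) => [j' ->|->]; first exact: contrapT (Bj j').
    exists x => k; case: (unliftP ord0 k) => [k' -> _|->]; last by rewrite eqxx.
    by rewrite /B liftK; apply: Ax.
  have Az : (\bigcap_i A i) z.
    by move=> i _; have := Bz (lift ord0 i); rewrite /B liftK.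
  by have := Bz ord0; rewrite /B unlift_none /= ltNge xm.
have xj : nearest0 (\bigcap_k A (lift j k)) x.
  split=> [k _|y Ay]; first exact: Ax.
  rewrite leNgt; apply/negP => yx; apply: Bj; exists y => k.
  case: (unliftP ord0 k) => [k' ->|-> _]; last by rewrite /B unlift_none.
  rewrite (inj_eq lift_inj) => k'j; rewrite /B liftK.
  by case: (unliftP j k') k'j => [k'' -> _|->]; [apply: Ay|rewrite eqxx].
exists j; rewrite (_ : nearest_pt _ = x); first exact: Ax.
apply: (@nearest0_unique (\bigcap_k A (lift j k))) => //.
  by apply: convex_set_bigcap => k _; exact: cA.
exact: (xgetPex 0 (ex_intro _ x xj)).
Qed.

End Norm.

(** * Fractional Helly theorem *)

Section FractionalHelly.
Context {R : realType} {d : nat}.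

Lemma leq_card_inj_in (T U : finType) (P : simpl_pred T) (Q : simpl_pred U)
    (f : T -> U) :
  {in P &, injective f} -> (forall x, P x -> Q (f x)) -> (#|P| <= #|Q|)%N.
Proof.
move=> f_inj PQ; rewrite -(card_in_image f_inj); apply: subset_leq_card.
by apply/fintype.subsetP => _ /fintype.imageP[x Px ->]; exact: PQ.
Qed.

Lemma leq_card_cover (T K : finType) (P : simpl_pred T) (Q : K -> simpl_pred T) :
  (forall x, P x -> exists k, Q k x) -> (#|P| <= \sum_k #|Q k|)%N.
Proof.
move=> PQ; rewrite -sum1_card.
apply: (@leq_trans (\sum_x \sum_k Q k x)); last first.
  rewrite exchange_big leq_sum // => k _.
  by rewrite -sum1_card [leqRHS]big_mkcond leq_sum.
rewrite big_mkcond leq_sum // => x _; case: ifP => // /PQ[k Qkx].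
by rewrite (bigD1 k) //= Qkx.
Qed.

Lemma card_fibers (T U : finType) (P : T -> pred U) :
  #|[pred u : T * U | P u.1 u.2]| = (\sum_x #|P x|)%N.
Proof.
rewrite -sum1_card big_mkcond.
rewrite -(pair_bigA _ (fun x y => if P x y then 1%N else 0%N)) /=.
by apply: eq_bigr => x _; rewrite -big_mkcond sum1_card.
Qed.

(** In a good tuple [z], the set at some position [k] contains the nearest point of the intersection
    of the sets at [d] other positions [s]. For fixed [(s, k)] that point does not depend on [z k],
    which leaves at most [m] choices for [z k]; there are [#|J| ^ d.+1] pairs [(s, k)]. *)
Lemma fractional_helly (I J : finType) (A : I -> set 'rV[R]_d) (c m : nat) :
  (forall i, convex_set (A i)) -> (forall i, compact (A i)) ->
  (forall x, (#|[pred i | `[< A i x >]]| <= m)%N) ->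
  (#|I| ^ #|J| <= c * #|[pred z : {ffun J -> I} |
     `[< exists2 f : 'I_d.+1 -> J, injective f &
           \bigcap_k A (z (f k)) !=set0 >]]|)%N ->
  (#|I| <= c * (#|J| ^ d.+1 * m))%N.
Proof.
move=> cA coA Am; set good := [pred z | _] => goodP.
have [I0|I0] := posnP #|I|; first by rewrite I0.
pose pt (z : {ffun J -> I}) (s : {ffun 'I_d -> J}) :=
  nearest_pt (\bigcap_k A (z (s k))).
pose Z (g : {ffun 'I_d -> J} * J) := [pred z : {ffun J -> I} |
  (g.2 \notin codom g.1) && `[< A (z g.2) (pt z g.1) >]].
have goodZ z : good z -> exists g, Z g z.
  move=> /asboolP[f f_inj /(nearest_pt_drop (fun i => cA (z (f i)))
    (fun i => coA (z (f i))))[j Aj]].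
  exists ([ffun k => f (lift j k)], f j); rewrite /Z /=; apply/andP; split.
    apply/negP => /codomP[k]; rewrite ffunE => /f_inj/eqP.
    by rewrite (negPf (neq_lift j k)).
  apply/asboolP; rewrite /pt (_ : \bigcap_k _ = \bigcap_k A (z (f (lift j k)))) //.
  by apply: eq_bigcapr => k _; rewrite ffunE.
have Zm g : (#|Z g| * #|I| <= #|I| ^ #|J| * m)%N.
  case: g => s k.
  have -> : (#|Z (s, k)| * #|I| = #|[pred u : {ffun J -> I} * I | Z (s, k) u.1]|)%N.
    rewrite (card_fibers (fun z (i : I) => Z (s, k) z)).
    rewrite (eq_bigr (fun z => if Z (s, k) z then #|I| else 0%N)) => [|z _].
      by rewrite -big_mkcond sum_nat_const.
    by case: ifP => h; [apply: eq_card|apply: eq_card0] => i; rewrite !inE.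
  (* Injective exchange: a tuple of [Z (s, k)] and a free index [i] become the tuple with [i] at
     position [k], together with the old [z k], one of at most [m] indices. *)
  pose upd (z : {ffun J -> I}) i := [ffun j => if j == k then i else z j].
  apply: (@leq_trans #|[pred u : {ffun J -> I} * I | `[< A u.2 (pt u.1 s) >]]|).
    apply: (@leq_card_inj_in _ _ _ _
      (fun u : {ffun J -> I} * I => (upd u.1 u.2, u.1 k))).
      move=> [z i] [z' i'] _ _ /= [/ffunP e zk].
      have := e k; rewrite !ffunE eqxx => ->; congr (_, _).
      apply/ffunP => j; have := e j; rewrite !ffunE.
      by case: eqP => [->|].
    move=> [z i] /= /andP[ks /asboolP Azk]; apply/asboolP => /=.
    rewrite (_ : pt (upd z i) s = pt z s) //; congr nearest_pt.
    apply: eq_bigcapr => l _; rewrite ffunE ifN //.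
    by apply: contraNneq ks => <-; exact: codom_f.
  rewrite (card_fibers (fun z i => `[< A i (pt z s) >])).
  rewrite -card_ffun -sum_nat_const; apply: leq_sum => z _.
  exact: Am.
have [c0|c0] := posnP c; first by move: goodP; rewrite c0 leqn0 expn_eq0 gtn_eqF.
rewrite -(@leq_pmul2l (#|I| ^ #|J|)) ?expn_gt0 ?I0 //.
apply: leq_trans (leq_mul goodP (leqnn _)) _.
rewrite -mulnA [leqRHS]mulnCA leq_pmul2l //.
apply: leq_trans (leq_mul (leq_card_cover goodZ) (leqnn _)) _.
rewrite big_distrl /=; apply: leq_trans (leq_sum _ (fun g _ => Zm g)) _.
rewrite sum_nat_const card_prod card_ffun card_ord -expnSr.
by rewrite mulnCA.
Qed.

(** If every point were in too few sets, the integer quotient of [#|I| - 1] by [b] could serve as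
    [m], giving [#|I| <= #|I| - 1]. *)
Lemma fractional_helly_point (I J : finType) (A : I -> set 'rV[R]_d) (c : nat) :
  (forall i, convex_set (A i)) -> (forall i, compact (A i)) -> (0 < #|I|)%N ->
  (#|I| ^ #|J| <= c * #|[pred z : {ffun J -> I} |
     `[< exists2 f : 'I_d.+1 -> J, injective f &
           \bigcap_k A (z (f k)) !=set0 >]]|)%N ->
  exists x, (#|I| <= c * #|J| ^ d.+1 * #|[pred i | `[< A i x >]]|)%N.
Proof.
move=> cA coA I0 goodP; apply: contrapT => /forallNP noP.
set b := (c * _)%N in noP.
have b0 : (0 < b)%N.
  rewrite lt0n; apply/eqP => b0; have := @fractional_helly I J A c #|I| cA coA.
  rewrite mulnA -/b b0 mul0n leqn0 (gtn_eqF I0) => /(_ _ goodP) H.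
  by have : false by apply: H => x; exact: max_card.
have := @fractional_helly I J A c (#|I|.-1 %/ b) cA coA.
rewrite mulnA -/b [(b * (_ %/ b))%N]mulnC => /(_ _ goodP) H.
have /H : forall x, (#|[pred i | `[< A i x >]]| <= #|I|.-1 %/ b)%N.
  move=> x; rewrite leq_divRL // mulnC -ltnS prednK // ltnNge.
  by apply/negP; exact: noP.
by move=> /leq_trans/(_ (leq_trunc_div _ _)); rewrite -ltnS prednK // ltnn.
Qed.

End FractionalHelly.

(** * Hulls of finite families and Tverberg-type partitions *)

Section Hull.
Context {R : realType} {d : nat}.
Local Notation V := 'rV[R]_d.

Definition hull (B : finType) (p : B -> V) : set V :=
  [set x | exists w : B -> R,
    [/\ forall b, 0 <= w b, \sum_b w b = 1 & x = \sum_b w b *: p b]].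

Lemma convex_hull (B : finType) (p : B -> V) : convex_set (hull p).
Proof.
apply/convex_setP => x y t t0 t1 [w [w0 w1 ->]] [v [v0 v1 ->]].
exists (fun b => t * w b + (1 - t) * v b); split=> [b| |].
- by rewrite addr_ge0 // mulr_ge0 // subr_ge0.
- by rewrite big_split -!mulr_sumr w1 v1 !mulr1 /= subrKC.
- rewrite !scaler_sumr -big_split; apply: eq_bigr => b _ /=.
  by rewrite [RHS]scalerDl !scalerA.
Qed.

Lemma mem_hull (B : finType) (p : B -> V) b : hull p (p b).
Proof.
exists (fun b' => (b' == b)%:R); split=> [b'||]; first exact: ler0n.
- by rewrite -natr_sum (bigD1 b) //= eqxx big1 // => b' /negPf ->.
- rewrite (bigD1 b) //= eqxx scale1r big1 ?addr0 // => b' /negPf ->.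
  by rewrite scale0r.
Qed.

Lemma sub_hull (B : finType) (p : B -> V) (A : set V) :
  convex_set A -> (forall b, A (p b)) -> hull p `<=` A.
Proof. by move=> cA Ap x [w [w0 w1 ->]]; exact: convex_comb. Qed.

(** The hull is a continuous image of the compact simplex of weights, written as row vectors through
    an enumeration of [B]. *)
Lemma compact_hull (B : finType) (p : B -> V) : compact (hull p).
Proof.
pose D : set 'rV[R]_#|B| := [set w | forall i, `[0, 1]%classic (w ord0 i)].
have coD : compact D.
  by apply: (@rV_compact R _ (fun=> `[0, 1]%classic)) => _; exact: segment_compact.
pose S : set 'rV[R]_#|B| := (fun w => \sum_i w 0 i) @^-1` [set 1].
have clS : closed S.
  apply: closed_comp; last exact: closed_eq.
  move=> w _; apply: continuous_big => [|i _]; first exact: add_continuous.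
  exact: coord_continuous.
rewrite (_ : hull p = (fun w => \sum_i w 0 i *: p (enum_val i)) @` (D `&` S)).
  apply: continuous_compact; last exact: compact_closedI.
  apply: continuous_subspaceT; apply: continuous_big => [|i _].
    exact: add_continuous.
  move=> w; apply: continuousZl; exact: coord_continuous.
have sE (M : nmodType) (F : B -> M) :
    \sum_b F b = \sum_(i < #|B|) F (enum_val i).
  by rewrite -big_enum_val.
apply/seteqP; split => [x [w [w0 w1 ->]]|_ [w [Dw Sw] <-]].
  exists (\row_i w (enum_val i)).
    split=> [i|]; rewrite /S /= ?mxE.
      rewrite /= in_itv /= w0 -w1 (bigD1 (enum_val i)) //= lerDl.
      by apply: sumr_ge0.
    rewrite -w1 [RHS]sE.
    by apply: eq_bigr => i _; rewrite mxE.
  rewrite [RHS]sE.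
  by apply: eq_bigr => i _; rewrite mxE.
exists (fun b => w 0 (enum_rank b)); split => [b||].
- by have := Dw (enum_rank b); rewrite /= in_itv /= => /andP[].
- rewrite -Sw [LHS]sE.
  by apply: eq_bigr => i _; rewrite enum_valK.
- rewrite [RHS]sE.
  by apply: eq_bigr => i _; rewrite enum_valK.
Qed.

(* Tverberg's theorem with a non-optimal number of points, by applying Radon's
   theorem to Radon points. *)
Lemma iterated_radon n : exists B L : finType, (n < #|L|)%N /\
  forall p : B -> V, exists (l : B -> L) x, forall a (A : set V),
    convex_set A -> (forall b, l b = a -> A (p b)) -> A x.
Proof.
elim: n => [|n [B [L [nL BL]]]].
  exists unit, unit; split=> [|p]; first by rewrite card_unit.
  by exists id, (p tt) => -[] A _; apply.
(* Each of [d + 2] copies of [B] has its point [y i], and Radon splits these points. The side of the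
   copy paired with the old label is the new label, so the number of labels doubles. *)
exists ('I_d.+2 * B)%type, (bool * L)%type; split=> [|p].
  by rewrite card_prod card_bool; lia.
have /choice[q /choice[y ly]] :
    forall i, exists (l : B -> L) x, forall a (A : set V),
    convex_set A -> (forall b, l b = a -> A (p (i, b))) -> A x.
  by move=> i; exact: BL.
have [S [z Sz]] := radon y.
exists (fun b => (S b.1, q b.1 b.2)), z => -[e a] A cA Ap.
apply: (Sz e) => // i Si; apply: (ly i a) => // b lb.
by apply: Ap; rewrite /= Si lb.
Qed.

End Hull.

(** * Selection lemma and weak epsilon-nets *)

Section WeakNet.
Context {R : realType} {d : nat}.
Local Notation V := 'rV[R]_d.

(** Fractional Helly for the hulls of all [B]-tuples. It needs a positive fraction of the [L]-tuples
    [w] of [B]-tuples to have [d + 1] meeting hulls. Every [w] becomes such a tuple under [mix l]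
    for some labelling [l]; each [mix l] is a bijection, and the number of labellings is fixed. *)
Lemma selection_lemma : exists (B : finType) (b : nat),
  forall (Y : finType) (p : Y -> V), (0 < #|Y|)%N ->
  exists x, (#|Y| ^ #|B| <= b *
    #|[pred z : {ffun B -> Y} | `[< hull (p \o z) x >]]|)%N.
Proof.
have [B [L [dL BL]]] := @iterated_radon R d d.
exists B, (#|{ffun B -> L}| * #|L| ^ d.+1)%N => Y p Y0; rewrite -card_ffun.
apply: (@fractional_helly_point _ _ _ L) => [z|z||].
- exact: convex_hull.
- exact: compact_hull.
- by rewrite card_ffun expn_gt0 Y0.
set good := [pred w | _].
have l0 : L by apply: (enum_val (Ordinal dL)).
(* At each place [b], [mix l] swaps the entries of [w l0] and [w (l b)], so the tuple at [a]
   receives all points of [w l0] labelled [a]. *)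
pose mix (l : {ffun B -> L}) (w : {ffun L -> {ffun B -> Y}}) :=
  [ffun a => [ffun b => w (tperm l0 (l b) a) b]].
have mixK l : involutive (mix l).
  by move=> w; apply/ffunP => a; apply/ffunP => b; rewrite !ffunE tpermK.
have mix_good w : exists l, good (mix l w).
  have [l [x lx]] := BL (p \o w l0).
  exists [ffun b => l b]; apply/asboolP.
  exists (fun k => enum_val (widen_ord dL k)).
    by move=> i j /enum_val_inj /(congr1 val) /= /val_inj.
  exists x => k _; set a := enum_val _; apply: (lx a); first exact: convex_hull.
  move=> b lb; have := mem_hull (p \o mix [ffun b => l b] w a) b.
  by rewrite /= !ffunE lb tpermR.
rewrite -card_ffun -(@eq_card _ (pred_of_simpl predT)) //.
apply: leq_trans (leq_card_cover (Q := fun l => [pred w | good (mix l w)]) _) _.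
  by move=> w _; exact: mix_good.
rewrite -sum_nat_const; apply: leq_sum => l _.
by apply: (leq_card_inj_in (f := mix l)) => // w w' _ _; exact: (inv_inj (mixK l)).
Qed.

(* Greedy construction: a convex set missing the points chosen so far contains
   a positive fraction of the hulls of [B]-tuples, and by the selection lemma
   one more point meets a positive fraction of these. *)
Lemma weak_epsilon_net (a : nat) : exists W : nat,
  forall (Y : finType) (p : Y -> V), exists s : seq V, (size s <= W)%N /\
    forall K : set V, convex_set K -> (0 < #|Y|)%N ->
      (#|Y| <= a * #|[pred y | `[< K (p y) >]]|)%N ->
      exists2 x, x \in s & K x.
Proof.
have [B [b sel]] := selection_lemma.
(* A missed [K] holds at least a fraction [1 / a ^ #|B|] of the tuples, and one point lies in
   [1 / b] of their hulls, so each round newly hits a fraction [1 / q]; [q + 1] rounds are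
   impossible. *)
pose q := (a ^ #|B| * b)%N; exists q.+1 => Y p.
have [Y0|] := eqVneq #|Y| 0%N; first by exists [::]; split=> // K _; rewrite Y0.
rewrite -lt0n => Y0.
pose is_net (s : seq V) := forall K : set V, convex_set K -> (0 < #|Y|)%N ->
      (#|Y| <= a * #|[pred y | `[< K (p y) >]]|)%N -> exists2 x, x \in s & K x.
pose miss (s : seq V) := [pred z : {ffun B -> Y} |
  `[< forall x, x \in s -> ~ hull (p \o z) x >]].
suff H k : (exists s, (size s <= k)%N /\ is_net s) \/
    (exists s, size s = k /\
       (q * #|miss s| + k * #|Y| ^ #|B| <= q * #|Y| ^ #|B|)%N).
  have [s_net|[s [_ U]]] := H q.+1; first exact: s_net.
  have X0 : (0 < #|Y| ^ #|B|)%N by rewrite expn_gt0 Y0.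
  by move: U; rewrite mulSn; lia.
elim: k => [|k [[s [sk s_net]]|[s [sk sU]]]].
- right; exists [::]; split=> //; rewrite addn0 leq_mul2l -card_ffun max_card.
  by rewrite orbT.
- by left; exists s; split=> //; exact: leqW.
have [s_net|] := pselect (is_net s); first by left; exists s; rewrite sk.
move=> /existsNP[K /not_implyP[cK /not_implyP[_ /not_implyP[Ka Ks]]]].
right; pose Y' : finType := {y : Y | `[< K (p y) >]}.
have cY' : #|Y'| = #|[pred y | `[< K (p y) >]]| by rewrite card_sig.
have Y'0 : (0 < #|Y'|)%N.
  by rewrite cY'; case: posnP Ka => // ->; rewrite muln0 leqNgt Y0.
have [x xP] := sel Y' (p \o val) Y'0.
exists (x :: s); split; first by rewrite /= sk.
pose new := [pred z : {ffun B -> Y} | miss s z && `[< hull (p \o z) x >]].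
have new_ge : (#|Y| ^ #|B| <= q * #|new|)%N.
  apply: (@leq_trans ((a * #|Y'|) ^ #|B|)%N).
    by case: #|B| => // e; rewrite leq_exp2r // cY'.
  rewrite expnMn /q -mulnA leq_mul2l; apply/orP; right.
  apply: leq_trans xP _; rewrite leq_mul2l; apply/orP; right.
  apply: (leq_card_inj_in (f := fun z : {ffun B -> Y'} => [ffun i => val (z i)])).
    move=> z z' _ _ /ffunP e; apply/ffunP => i; apply: val_inj.
    by have := e i; rewrite !ffunE.
  move=> z /asboolP zx.
  have e : p \o [ffun i => val (z i)] = (p \o val) \o z.
    by apply/funext => i /=; rewrite ffunE.
  apply/andP; split; last by apply/asboolP; rewrite e.
  (* The hull of a tuple from [K] stays in [K], which contains no point of [s]; the tuple was
     therefore missed so far. *)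
  apply/asboolP => y ys yz; apply: Ks; exists y => //.
  move: yz; rewrite e; apply: sub_hull => // i /=.
  by apply/asboolP; exact: (valP (z i)).
have : (#|miss (x :: s)| + #|new| <= #|miss s|)%N.
  rewrite -(cardID new (miss s)) addnC leq_add //.
    apply: subset_leq_card; apply/fintype.subsetP => z.
    by rewrite !inE => /andP[-> ->].
  apply: subset_leq_card; apply/fintype.subsetP => z.
  rewrite !inE => /asboolP/asboolP zx; apply/andP; split.
    rewrite negb_and; apply/orP; right; apply/asboolPn => zx'.
    by apply: (zx x) => //; rewrite mem_head.
  by apply/asboolP => y ys; apply: zx; rewrite inE ys orbT.
move=> /(leq_mul (leqnn q)); rewrite mulnDr; lia.
Qed.

End WeakNet.

(** * The (p,q) argument *)

Section AlonKleitman.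
Context {R : realType} {d : nat}.
Local Notation V := 'rV[R]_d.

(** Bernoulli's inequality [1 + k / c <= (1 + 1 / c) ^ k], cleared of denominators. *)
Lemma bernoulli_nat (c k : nat) : (c ^ k * (c + k) <= c * c.+1 ^ k)%N.
Proof.
elim: k => [|k IHk]; first by rewrite !expn0; lia.
rewrite !expnS; move: (c ^ k)%N (c.+1 ^ k)%N IHk => u v; nia.
Qed.

(* Multiplicative weights: [i] has weight [2 ^ (size s - hits)], so sets
   rarely hit by [s] dominate the choice of the next point. *)
Lemma fractional_piercing (T : Type) (I : finType) (A : I -> set T) (B : nat) :
  (forall w : I -> nat, (0 < \sum_i w i)%N ->
     exists x, (\sum_i w i <= B * \sum_(i | `[< A i x >]) w i)%N) ->
  exists s : seq T, (0 < #|I| -> 0 < size s)%N /\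
    forall i, (size s <= 3 * B.*2.-1 * count (fun x => `[< A i x >]) s)%N.
Proof.
move=> Bw; have [I0|] := eqVneq #|I| 0%N.
  by exists [::]; rewrite I0.
rewrite -lt0n => I0; set n := #|I| in I0 *.
pose hits i s := count (fun x => `[< A i x >]) s.
pose w (s : seq T) i := (2 ^ (size s - hits i s))%N.
have w_gt0 s : (0 < \sum_i w s i)%N.
  have [i _] : exists i : I, i \in I by apply/card_gt0P.
  by rewrite (bigD1 i) //= addn_gt0 expn_gt0.
have B0 : (0 < B)%N.
  have [x] := Bw _ (w_gt0 [::]); case: (B) => //.
  by rewrite mul0n leqNgt w_gt0.
set c := B.*2.-1.
have cS : c.+1 = (2 * B)%N by rewrite prednK ?double_gt0 // mul2n.
have step k : exists s, size s = k /\ (B ^ k * \sum_i w s i <= c ^ k * n)%N.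
  elim: k => [|k [s [sk sU]]].
    exists [::]; split=> //; rewrite !expn0 !mul1n.
    by rewrite /w /= sum_nat_const expn0 muln1.
  have [x xw] := Bw _ (w_gt0 s); exists (x :: s); split; first by rewrite /= sk.
  (* Sets containing [x] keep their weight and the others double. As the former carry at least
     [1 / B] of the total, it grows by a factor of at most [c / B = 2 - 1 / B]. *)
  have E : (\sum_i w (x :: s) i + \sum_(i | `[< A i x >]) w s i =
            2 * \sum_i w s i)%N.
    rewrite [X in (_ + X)%N]big_mkcond -big_split big_distrr /=.
    apply: eq_bigr => i _; rewrite /w /= -/(hits i s).
    have hs : (hits i s <= size s)%N by exact: count_size.
    case: ifP => _ /=; first by rewrite add1n subSS addnn mul2n.
    by rewrite add0n addn0 subSn // expnS.
  rewrite !expnS; move: sU E xw.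
  move: (\sum_i w s i)%N (\sum_i w (x :: s) i)%N
    (\sum_(i | `[< A i x >]) w s i)%N (B ^ k)%N (c ^ k)%N.
  move=> W W' H b ck sU E xw.
  have e1 : (B * W' + B * H = 2 * B * W)%N by rewrite -mulnDr E mulnCA mulnA.
  have e2 : (c * W + W = 2 * B * W)%N by rewrite -cS mulSn addnC.
  have H1 : (B * W' <= c * W)%N by lia.
  apply: (@leq_trans (b * (B * W'))%N); first by lia.
  apply: (@leq_trans (b * (c * W))%N); first by rewrite leq_mul2l H1 orbT.
  by rewrite mulnCA -mulnA leq_mul2l sU orbT.
(* After [3 * c * n] rounds a set hit fewer than [n] times would weigh too much: with
   [(1 + 1 / c) ^ (3 * c) >= 4] the bound on the total weight yields [2 ^ n <= n]. *)
set a := (3 * c)%N; have [s [sT sU]] := step (a * n)%N.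
have c0 : (0 < c)%N by lia.
exists s; split=> [_|i]; first by rewrite sT !muln_gt0 c0.
rewrite leqNgt -/(hits i s); apply/negP => hi.
have {}hi : (hits i s < n)%N.
  by rewrite -(@ltn_pmul2l a) -?sT // muln_gt0 c0.
have a1 : (1 <= a)%N by lia.
have nT : (n <= a * n)%N by rewrite leq_pmull.
have H1 : (B ^ (a * n) * 2 ^ (a * n - n) <= c ^ (a * n) * n)%N.
  apply: leq_trans sU; rewrite leq_mul2l; apply/orP; right.
  rewrite (bigD1 i) //=; apply: leq_trans (leq_addr _ _).
  by rewrite /w leq_pexp2l // sT leq_sub2l // ltnW.
have H2 : (4 ^ n * c ^ (a * n) <= (2 * B) ^ (a * n))%N.
  rewrite !(expnM _ a) -expnMn; case: (n) => // m; rewrite leq_exp2r // -cS.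
  rewrite -(@leq_pmul2l c) //; apply: leq_trans _ (bernoulli_nat _ _).
  by rewrite /a; lia.
have H3 : ((2 * B) ^ (a * n) <= 2 ^ n * (c ^ (a * n) * n))%N.
  apply: leq_trans _ (leq_mul (leqnn _) H1).
  by rewrite expnMn mulnCA -expnD subnKC // mulnC.
have := leq_trans H2 H3.
rewrite (_ : 4 = 2 * 2)%N // expnMn -mulnA leq_pmul2l ?expn_gt0 //.
rewrite mulnC leq_pmul2l ?expn_gt0 ?c0 // leqNgt.
by rewrite ltn_expl.
Qed.

Lemma pigeonhole_points (N t : nat) (A : 'I_N -> set V) (s : seq V) :
  (size s <= t)%N -> (t * d < N)%N -> (forall j, exists2 x, x \in s & A j x) ->
  exists2 f : 'I_d.+1 -> 'I_N, injective f & \bigcap_k A (f k) !=set0.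
Proof.
move=> st tN sA; have [x xd] : exists x, (d < #|[pred j | `[< A j x >]]|)%N.
  apply: contrapT => /forallNP H; move: tN; rewrite ltnNge => /negP; apply.
  rewrite -[leqLHS]card_ord.
  have sA' j : [pred _ : 'I_N | true] j ->
      exists k : 'I_(size s), [pred j | `[< A j (tnth (in_tuple s) k) >]] j.
    move=> _; have [x /seq_tnthP[k ->] Ajx] := sA j.
    by exists k; apply/asboolP.
  rewrite -(@eq_card _ [pred _ : 'I_N | true]) //.
  apply: leq_trans (leq_card_cover sA') _.
  apply: (@leq_trans (\sum_(k < size s) d)).
    by apply: leq_sum => k _; rewrite leqNgt; apply/negP; exact: H.
  by rewrite sum_nat_const card_ord leq_mul2r st orbT.
exists (fun k => enum_val (widen_ord xd k)).
  by move=> i j /enum_val_inj /(congr1 val) /= /val_inj.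
exists x => k _.
by have := enum_valP (widen_ord xd k) => /asboolP.
Qed.

(** Multiplicative weights give a sequence of points of which every set contains a fixed fraction; a
    weak epsilon-net of that sequence pierces all sets. *)
Lemma alon_kleitman (t : nat) : exists f : nat,
  forall (I : finType) (A : I -> set V),
  (forall i, convex_set (A i)) -> (forall i, compact (A i)) ->
  (forall z : 'I_(t * d).+1 -> I, exists s : seq V, (size s <= t)%N /\
     forall j, exists2 x, x \in s & A (z j) x) ->
  exists s : seq V, (size s <= f)%N /\ forall i, exists2 x, x \in s & A i x.
Proof.
set N := (t * d).+1; pose B := (N ^ d.+1)%N.
have [f net] := @weak_epsilon_net R d (3 * B.*2.-1); exists f => I A cA coA tA.
have [|s [s0 sA]] := @fractional_piercing V I A B.
  move=> w w0.
  (* Weights become multiplicities: [I'] has [w i] copies of [i]. By the hypothesis and the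
     pigeonhole principle every [N]-tuple of copies is good, so fractional Helly applies with
     constant 1. *)
  pose I' : finType := {i : I & 'I_(w i)}.
  have cI' : #|I'| = (\sum_i w i)%N.
    rewrite -sum1_card.
    rewrite -(sig_big_dep (fun=> true) (fun _ _ => true) (fun _ _ => 1%N)) /=.
    by apply: eq_bigr => i _; rewrite sum1_card card_ord.
  have [||||x] := @fractional_helly_point R d I' 'I_N (fun u => A (tag u)) 1.
  - by move=> u.
  - by move=> u.
  - by rewrite cI'.
  - rewrite mul1n -card_ffun; apply: subset_leq_card.
    apply/fintype.subsetP => z _; apply/asboolP.
    have [s [st sz]] := tA (fun j => tag (z j)).
    exact: (@pigeonhole_points N t (fun j => A (tag (z j))) s).
  rewrite mul1n card_ord cI' => xw; exists x.
  rewrite (_ : \sum_(i | `[< A i x >]) w i =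
               #|[pred u : I' | `[< A (tag u) x >]]|)%N //.
  rewrite -sum1_card (eq_bigl (fun u : I' => `[< A (tag u) x >] && true)).
    rewrite -(sig_big_dep (fun i => `[< A i x >]) (fun _ _ => true)
      (fun _ _ => 1%N)) /=.
    by apply: eq_bigr => i _; rewrite sum1_card card_ord.
  by move=> u; rewrite andbT.
have [s' [s'f s'A]] := net 'I_(size s) (tnth (in_tuple s)).
exists s'; split=> // i; apply: s'A => //; rewrite card_ord.
  by apply: s0; apply/card_gt0P; exists i.
rewrite (leq_trans (sA i)) // leq_mul2l -sum1_card; apply/orP; right.
rewrite -[X in count _ X](map_tnth_enum (in_tuple s)) count_map.
by rewrite -sum1_count big_enum_cond leq_sum.
Qed.

End AlonKleitman.

(** * Flats and separation inside a flat *)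

Section Flats.
Context {R : realType} {d : nat}.
Local Notation V := 'rV[R]_d.
Implicit Types (p q u : V) (U : 'M[R]_d).

(** The translate by [p] of the row space of [U], of dimension [\rank U]. *)
Definition flat p U : set V := [set x | (x - p <= U)%MS].

Lemma convex_flat p U : convex_set (flat p U).
Proof.
apply/convex_setP => x y t _ _ xp yp; rewrite /flat /=.
have -> : t *: x + (1 - t) *: y - p = t *: (x - p) + (1 - t) *: (y - p).
  by apply/rowP => k; rewrite !mxE; ring.
by rewrite addmx_sub // scalemx_sub.
Qed.

Lemma closed_flat p U : closed (flat p U).
Proof.
have -> : flat p U = \bigcap_(k in [set: 'I_d])
    ((fun x : V => dotmx (x - p) (col k (cokermx U))^T) @^-1` [set 0]).
  apply/seteqP; split=> x; rewrite /flat /= submxE.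
    move=> /eqP /rowP xp k _; have := xp k; rewrite !mxE /= => xpk.
    by rewrite -[RHS]xpk; apply: eq_bigr => i _; rewrite !mxE.
  move=> xp; apply/eqP/rowP => k; rewrite !mxE -[RHS](xp k) //.
  by apply: eq_bigr => i _; rewrite !mxE.
apply: closed_bigI => k _; apply: closed_comp; last exact: closed_eq.
move=> x _; apply: continuous_dotmx; last by move=> ?; exact: cst_continuous.
by move=> y; apply: continuousB => //; exact: cst_continuous.
Qed.

Lemma flat_hyperplane p q u U y :
  flat p U q -> flat p U y -> dotmx u (y - q) = 0 ->
  flat q (U :&: kermx u^T)%MS y.
Proof.
move=> qU yU uy; rewrite /flat /= sub_capmx; apply/andP; split.
  by rewrite -[y - q](subrKA p) addmx_sub // -opprB eqmx_opp.
apply/sub_kermxP/rowP => k; rewrite !mxE -[RHS]uy ord1.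
by apply: eq_bigr => i _; rewrite !mxE mulrC.
Qed.

(** [u] lies in [U] but is not orthogonal to itself, so the intersection is a proper subspace. *)
Lemma rank_hyperplane u U : (u <= U)%MS -> u != 0 ->
  (\rank (U :&: kermx u^T)%MS <= (\rank U).-1)%N.
Proof.
move=> uU u0; suff : (\rank (U :&: kermx u^T)%MS < \rank U)%N.
  by case: (\rank U).
apply: rank_ltmx; rewrite ltmxE capmxSl /=; apply: contra u0.
move=> /(submx_trans uU); rewrite sub_capmx => /andP[_ /sub_kermxP /rowP/(_ 0)].
rewrite !mxE => uu; rewrite -dotmx_eq0 -uu; apply/eqP.
by apply: eq_bigr => i _; rewrite !mxE.
Qed.

(** First-order condition: for [a < 0] the step [t = - a / (b - a)] gives [t * b <= - a], so the
    bracket is at most [a]. *)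
Lemma slope_ge0 (a b : R) : 0 <= b ->
  (forall t, 0 <= t -> t <= 1 -> 0 <= t * (2 * a + t * b)) -> 0 <= a.
Proof.
move=> b0 H; rewrite leNgt; apply/negP => a0.
have ba : 0 < b - a by lra.
have t0 : 0 < - a / (b - a) by rewrite divr_gt0 //; lra.
have /(H _ (ltW t0)) : - a / (b - a) <= 1 by rewrite ler_pdivrMr //; lra.
rewrite pmulr_rge0 //.
have : - a / (b - a) * b <= - a.
  by rewrite mulrAC ler_pdivrMr // ler_wpM2l //; lra.
lra.
Qed.

(* [x] minimizes the sum of the [|x i - x j|^2] over the product of the [D i],
   and [v i] is proportional to the gradient in the variable [x i]. *)
Lemma separating_functionals (I : finType) (D : I -> set V) :
  (forall i, convex_set (D i)) -> (forall i, compact (D i)) ->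
  (forall i, D i !=set0) -> ~ (exists x, forall i, D i x) ->
  exists x v : I -> V,
    [/\ forall i, D i (x i), forall i, v i = \sum_j (x i - x j),
        forall i y, D i y -> 0 <= dotmx (v i) (y - x i)
      & forall y, \sum_i dotmx (v i) (y - x i) < 0].
Proof.
move=> cD coD /choice[x0 Dx0] nD.
(* [B f f] is the function to minimize, and [B x g] is half its derivative at [x] in direction
   [g]. *)
pose B (f g : I -> V) : R := \sum_i \sum_j dotmx (f i - f j) (g i - g j).
have [x Dx xmin] : exists2 x : I -> V, (forall i, D i (x i)) &
    forall y : I -> V, (forall i, D i (y i)) -> B x x <= B y y.
  pose P : set (prod_topology (fun _ : I => V)) := [set f | forall i, D i (f i)].
  have coP : compact P by exact: tychonoff.
  have P0 : P !=set0 by exists x0.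
  have [|x /set_mem Px xm] := @compact_EVT_min
      (prod_topology (fun _ : I => V)) R (fun f => B f f) P P0 coP.
    apply: continuous_subspaceT.
    apply: continuous_big => [|i _]; first exact: add_continuous.
    apply: continuous_big => [|j _]; first exact: add_continuous.
    by apply: continuous_dotmx => f; apply: continuousB; exact: proj_continuous.
  by exists x => // y Dy; apply: xm; exact: mem_set.
pose v i := \sum_j (x i - x j).
have Bv g : B x g = 2 * \sum_i dotmx (v i) (g i).
  rewrite mulr_natl mulr2n /B.
  under eq_bigr => i _ do under eq_bigr => j _ do
    rewrite dotmxDr dotmxNr -dotmxNl opprB.
  under eq_bigr => i _ do rewrite big_split.
  rewrite big_split /= [X in _ + X]exchange_big /=.
  by congr (_ + _); apply: eq_bigr => i _; rewrite dotmx_suml.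
have B0 f : 0 <= B f f.
  by apply: sumr_ge0 => i _; apply: sumr_ge0 => j _; exact: dotmx_ge0.
have v0 : \sum_i v i = 0.
  rewrite /v; under eq_bigr do rewrite sumrB.
  by rewrite sumrB exchange_big subrr.
exists x, v; split=> // [i y Dy|y].
  (* Only the [i]-th point moves, towards [y]; it stays in [D i], so minimality gives a nonnegative
     slope. *)
  pose g j := if j == i then y - x i else 0.
  have Dg t : 0 <= t -> t <= 1 -> forall j, D j (x j + t *: g j).
    move=> t0 t1 j; rewrite /g; case: eqP => [->|_]; last by rewrite scaler0 addr0.
    have -> : x i + t *: (y - x i) = t *: y + (1 - t) *: x i.
      by rewrite scalerBr scalerBl scale1r addrC addrAC addrA.
    by have /convex_setP := cD i; apply.
  suff : 0 <= B x g.
    rewrite Bv pmulr_rge0 // (bigD1 i) //= {1}/g eqxx big1 ?addr0 // => j /negPf ji.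
    by rewrite /g ji dotmxC dotmx0l.
  apply: (@slope_ge0 _ (B g g)) => // t t0 t1.
  have := xmin _ (Dg t t0 t1); rewrite -subr_ge0.
  suff -> : B (fun j => x j + t *: g j) (fun j => x j + t *: g j) - B x x =
    t * (2 * B x g + t * B g g) by [].
  rewrite /B -sumrB mulrDr !mulr_sumr -big_split; apply: eq_bigr => j _ /=.
  rewrite -sumrB !mulr_sumr -big_split; apply: eq_bigr => k _ /=.
  have -> : x j + t *: g j - (x k + t *: g k) = x j - x k + t *: (g j - g k).
    by rewrite scalerBr opprD addrACA.
  move: (x j - x k) (g j - g k) => X G; rewrite !dotmxE (dotmxC G X); ring.
(* As the [v i] sum to zero, the value is [- B x x / 2] for every [y]. It could vanish only if all
   [x i] coincided, which would give a common point. *)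
have -> : \sum_i dotmx (v i) (y - x i) = - \sum_i dotmx (v i) (x i).
  under eq_bigr do rewrite dotmxDr dotmxNr.
  by rewrite sumrB -dotmx_suml v0 dotmx0l sub0r.
rewrite oppr_lt0 -(@pmulr_rgt0 _ 2) // -Bv lt_def B0 andbT.
apply/negP; rewrite psumr_eq0 => [/allP Bx0|i _]; last first.
  by apply: sumr_ge0 => j _; exact: dotmx_ge0.
have [i0 _|I0] := pickP (@predT I); last by apply: nD; exists 0 => i; have := I0 i.
apply: nD; exists (x i0) => j.
have := Bx0 i0; rewrite mem_index_enum /= psumr_eq0 => [/(_ isT)|k _]; last first.
  exact: dotmx_ge0.
move=> /allP/(_ j); rewrite mem_index_enum /= dotmx_eq0 subr_eq0 => /(_ isT)/eqP ->.
exact: Dx.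
Qed.

(** The half-spaces [0 <= dotmx (v i) (y - x i)] contain the pieces [D i] and have no common point.
    A point [y] of [K] in the flat thus violates one of them, while [K] also meets [D i]; the
    segment in between crosses the bounding hyperplane. *)
Lemma flat_cut (I : finType) (C : I -> set V) p U :
  (forall i, convex_set (C i)) -> (forall i, compact (C i)) ->
  ~ (exists2 x, flat p U x & forall i, C i x) ->
  exists s : seq (V * 'M[R]_d),
    [/\ (size s <= #|I|)%N,
        forall e, e \in s -> (\rank e.2 <= (\rank U).-1)%N
      & forall K : set V, convex_set K ->
          (forall i, K `&` C i `&` flat p U !=set0) ->
          exists2 e, e \in s & K `&` flat e.1 e.2 !=set0].
Proof.
move=> cC coC nC; pose D i := C i `&` flat p U.
have [D0|] := pselect (forall i, D i !=set0); last first.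
  move=> /existsNP[i Di]; exists [::]; split=> // K _ /(_ i)[x [[Kx Cx] xU]].
  by case: Di; exists x.
have [i0 _|I0] := pickP (@predT I); last first.
  case: nC; exists p => [|i]; first by rewrite /flat /= subrr sub0mx.
  by have := I0 i.
have nD : ~ (exists x, forall i, D i x).
  by move=> [x Dx]; apply: nC; exists x => [|i]; [case: (Dx i0)|case: (Dx i)].
have cD i : convex_set (D i) by apply: convex_setI => //; exact: convex_flat.
have coD i : compact (D i) by apply: compact_closedI => //; exact: closed_flat.
have [x [v [Dx vE vD vy]]] := separating_functionals cD coD D0 nD.
have vU i : (v i <= U)%MS.
  rewrite vE summx_sub // => j _; rewrite -[x i - x j](subrKA p).
  have [[_ xi] [_ xj]] := (Dx i, Dx j).
  by rewrite addmx_sub // -opprB eqmx_opp.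
(* Only a nonzero [v i] bounds a hyperplane of the flat; a zero one imposes no condition. *)
exists [seq (x i, (U :&: kermx (v i)^T)%MS) | i <- enum I & v i != 0]; split.
- by rewrite size_map size_filter (leq_trans (count_size _ _)) // -cardE.
- move=> e /mapP[i]; rewrite mem_filter => /andP[vi _] -> /=.
  exact: rank_hyperplane.
move=> K cK KD; apply: contrapT => nK.
have [y [[Ky Cy] yU]] := KD i0.
have := vy y; rewrite ltNge => /negP; apply; apply: sumr_ge0 => i _.
have [vi0|vi] := eqVneq (v i) 0; first by rewrite vi0 dotmx0l.
have [z [[Kz Cz] zU]] := KD i.
have vz : 0 <= dotmx (v i) (z - x i) by exact: vD.
rewrite leNgt; apply/negP => vy0; apply: nK.
set a := dotmx (v i) (z - x i) in vz; set b := dotmx (v i) (y - x i) in vy0.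
have ab : 0 < a - b by lra.
pose t := - b / (a - b); pose m := t *: z + (1 - t) *: y.
have t0 : 0 <= t by rewrite divr_ge0 ?ltW //; lra.
have t1 : t <= 1 by rewrite ler_pdivrMr //; lra.
exists (x i, (U :&: kermx (v i)^T)%MS).
  by apply/mapP; exists i => //; rewrite mem_filter vi mem_enum.
exists m; split; first by move/convex_setP: cK; apply.
apply: (@flat_hyperplane p) => /=.
- by case: (Dx i).
- by have /convex_setP := @convex_flat p U; apply.
have -> : m - x i = t *: (z - x i) + (1 - t) *: (y - x i).
  by apply/rowP => k; rewrite !mxE; ring.
rewrite dotmxDr !dotmxZr -/a -/b /t; field; lra.
Qed.

End Flats.

(** * Flats crossed by every set that meets all rainbow intersections *)

Section Transversals.
Context {R : realType} {d : nat}.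
Local Notation V := 'rV[R]_d.

Definition pierced (n : nat) (I : Type) (P : set I) (A : I -> set V) : Prop :=
  exists s : seq V, (size s <= n)%N /\ forall i, P i -> exists2 x, x \in s & A i x.

Lemma piercedW (n n' : nat) (I : Type) (P : set I) (A : I -> set V) :
  (n <= n')%N -> pierced n P A -> pierced n' P A.
Proof. by move=> nn' [s [sn sA]]; exists s; split=> //; exact: leq_trans nn'. Qed.

(** [alon_kleitman], contraposed, for the subfamily [P]; the sample may repeat indices. *)
Lemma unpierced_sample (t : nat) : exists f : nat,
  forall (I : finType) (P : set I) (A : I -> set V),
  (forall i, convex_set (A i)) -> (forall i, compact (A i)) ->
  ~ pierced f P A ->
  exists z : 'I_(t * d).+1 -> I, (forall j, P (z j)) /\ ~ pierced t setT (A \o z).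
Proof.
have [f AK] := @alon_kleitman R d t; exists f => I P A cA coA nP.
apply: contrapT => /forallNP nz; apply: nP.
pose I' : finType := {i : I | `[< P i >]}.
have [|||s [sf sA]] := AK I' (fun u => A (val u)).
- by move=> u.
- by move=> u.
- move=> z; apply: contrapT => ns.
  apply: (nz (val \o z)); split=> [j|[s [st sA]]].
    by apply/asboolP; exact: (valP (z j)).
  by apply: ns; exists s; split=> // j; exact: sA.
exists s; split=> // i /asboolP Pi.
exact: (sA (Sub i Pi)).
Qed.

Lemma size_flatten_map (T U : Type) (F : T -> seq U) (n : nat) (s : seq T) :
  (forall x, size (F x) <= n)%N ->
  (size (flatten [seq F x | x <- s]) <= size s * n)%N.
Proof.
move=> Fn; elim: s => //= x s IHs.
by rewrite size_cat mulSn leq_add.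
Qed.

(** [K] ranges over all compact convex sets, because the induction hypothesis is applied to [K] cut
    by a sample set of the new class. The flats are chosen before [K]. *)
Lemma flat_transversal (k : nat) : exists f g : nat,
  forall (I : finType) (A : I -> set V) (c : 'I_k -> set I),
  (forall i, convex_set (A i)) -> (forall i, compact (A i)) ->
  (forall j, ~ pierced f (c j) A) ->
  exists s : seq (V * 'M[R]_d),
    [/\ (size s <= g)%N, forall e, e \in s -> (\rank e.2 <= d - k)%N
      & forall K : set V, convex_set K -> compact K ->
        (forall a : 'I_k -> I, (forall j, c j (a j)) ->
           exists2 x, K x & forall j, A (a j) x) ->
        exists2 e, e \in s & K `&` flat e.1 e.2 !=set0].
Proof.
elim: k => [|k [f [g IHk]]].
  exists 0%N, 1%N => I A c _ _ _; exists [:: (0, 1%:M)]; split=> //.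
    by move=> e; rewrite inE => /eqP -> /=; rewrite subn0 rank_leq_row.
  move=> K _ _ KA; exists (0, 1%:M); first exact: mem_head.
  have a0 : 'I_0 -> I by case.
  by have [|x Kx _] := KA a0; [case|exists x; split=> //; exact: submx1].
have [f' sample] := unpierced_sample g; set N := (g * d).+1 in sample.
(* At most [N] hyperplanes for each of the [g] flats and each subset of the sample as colour
   class. *)
exists (maxn f f'), (g * (#|{set 'I_N}| * N))%N => I A c cA coA nc.
have [|s [sg sr sK]] := IHk I A (fun j => c (lift ord0 j)) cA coA.
  by move=> j /(piercedW (leq_maxl f f')); exact: nc.
have [|z [zc nz]] := sample I (c ord0) A cA coA.
  by move=> /(piercedW (leq_maxr f f')); exact: nc.
have cutE (eJ : (V * 'M[R]_d) * {set 'I_N}) : exists r : seq (V * 'M[R]_d),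
    [/\ (size r <= N)%N,
        forall e, e \in r -> (\rank e.2 <= (\rank eJ.1.2).-1)%N
      & forall K : set V, convex_set K ->
          (forall j, j \in eJ.2 -> K `&` A (z j) `&` flat eJ.1.1 eJ.1.2 !=set0) ->
          ~ (exists2 x, flat eJ.1.1 eJ.1.2 x & forall j, j \in eJ.2 -> A (z j) x) ->
          exists2 e, e \in r & K `&` flat e.1 e.2 !=set0].
  case: eJ => -[p U] J /=; pose I' : finType := {j : 'I_N | j \in J}.
  have [Jx|nJ] := pselect
    (exists2 x, flat p U x & forall j, j \in J -> A (z j) x).
    by exists [::]; split=> // K _ _ [].
  have [|||r [rN rr rK]] := @flat_cut R d I' (fun u => A (z (val u))) p U.
  - by move=> u.
  - by move=> u.
  - move=> [x xU xJ]; apply: nJ; exists x => // j jJ.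
    exact: (xJ (Sub j jJ)).
  exists r; split=> //.
    by rewrite (leq_trans rN) // card_sig -[leqRHS]card_ord max_card.
  by move=> K cK KJ _; apply: rK => // u; exact: KJ (valP u).
have [cut cutP] := choice cutE.
exists (flatten [seq flatten [seq cut (e, J) | J <- enum {set 'I_N}] | e <- s]).
split=> [||K cK coK KA].
- apply: (leq_trans (size_flatten_map (n := #|{set 'I_N}| * N) _ _)).
    move=> e; rewrite cardE; apply: size_flatten_map => J.
    by case: (cutP (e, J)).
  by rewrite leq_mul2r sg orbT.
- move=> e /flatten_mapP[e' e's /flatten_mapP[J _ eJ]].
  have [_ /(_ e eJ) /= er _] := cutP (e', J).
  by rewrite (leq_trans er) // subnS -!subn1 leq_sub2r // sr.
have /choice[col colP] : forall j : 'I_N, exists l : 'I_(size s),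
    K `&` A (z j) `&` flat (tnth (in_tuple s) l).1 (tnth (in_tuple s) l).2 !=set0.
  move=> j; have [|||e /seq_tnthP[l ->] eK] := sK (K `&` A (z j)).
  - exact: convex_setI.
  - by apply: compact_closedI => //; apply: compact_closed => //;
      exact: norm_hausdorff.
  (* A selection from the old classes, completed by [z j] in the new one, is rainbow, so its
     intersection meets [K] inside [A (z j)]. *)
  - move=> a ca; pose a' i := if unlift ord0 i is Some i' then a i' else z j.
    have [|x Kx xa] := KA a'.
      by move=> i; rewrite /a'; case: unliftP => [i' ->|->].
    exists x => [|i]; last by have := xa (lift ord0 i); rewrite /a' liftK.
    by split=> //; have := xa ord0; rewrite /a' unlift_none.
  by exists l.
(* If each colour class had a common point in its flat, these at most [g] points would pierce the
   sample. *)
have [l nl] : exists l : 'I_(size s), ~ exists2 x,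
    flat (tnth (in_tuple s) l).1 (tnth (in_tuple s) l).2 x &
    forall j, j \in [set j | col j == l]%SET -> A (z j) x.
  apply: contrapT => /forallNP H; apply: nz.
  have /choice[x xP] : forall l : 'I_(size s), exists x,
      forall j, col j = l -> A (z j) x.
    move=> l; have [x _ xA] := contrapT (H l).
    by exists x => j jl; apply: xA; rewrite finset.inE jl.
  exists [seq x l | l <- enum 'I_(size s)]; split.
    by rewrite size_map size_enum_ord.
  move=> j _; exists (x (col j)); last exact: xP.
  by apply: map_f; rewrite mem_enum.
set e := tnth (in_tuple s) l in nl.
set J : {set 'I_N} := [set j | col j == l]%SET in nl.
have [_ _ /(_ K cK _ nl)[|e' e'r e'K]] := cutP (e, J).
  by move=> j; rewrite finset.inE => /eqP jl; have := colP j; rewrite jl.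
exists e' => //; apply/flatten_mapP; exists e; first exact: mem_tnth.
by apply/flatten_mapP; exists J => //; rewrite mem_enum.
Qed.

Lemma flat_sub_line (p : V) (U : 'M[R]_d) : (0 < d)%N -> (\rank U <= 1)%N ->
  exists2 v : V, v != 0 & flat p U `<=` [set p + t *: v | t in [set: R]].
Proof.
move=> d0 U1; have [v v0 Uv] : exists2 v : V, v != 0 & (U <= v)%MS.
  (* A flat reduced to a point gets an arbitrary direction. *)
  have [->|U0] := eqVneq U 0.
    exists (delta_mx 0 (Ordinal d0)); last exact: sub0mx.
    apply/rV0Pn; exists (Ordinal d0); rewrite mxE !eqxx.
    exact: oner_neq0.
  exists (nz_row U); first by rewrite nz_row_eq0.
  have := mxrank_leqif_sup (nz_row_sub U).
  rewrite rank_rV nz_row_eq0 U0 => -[] _ <-.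
  rewrite eqn_leq U1 andbT lt0n mxrank_eq0 //.
exists v => // x /= xU.
have /sub_rVP[t xt] := submx_trans xU Uv.
by exists t => //; rewrite -xt addrC subrK.
Qed.

End Transversals.

(** * Lines for compact families, and reduction of the general case *)

Section ColorfulFamilies.
Context {R : realType}.

(** For each colour [j0] the other [d - 1] classes yield at most [g] flats of rank at most one.
    Every set of class [j0] meets all rainbow intersections of the others, hence crosses one of
    these flats; over all colours this makes [d * g] lines. *)
Lemma colorful_transversal (d : nat) (hd : (0 < d)%N) : exists f g : nat,
  forall (I : finType) (A : I -> set 'rV[R]_d) (c : 'I_d -> set I),
  (forall i, convex_set (A i)) -> (forall i, compact (A i)) ->
  (forall a : 'I_d -> I, (forall j, c j (a j)) -> exists x, forall j, A (a j) x) ->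
  (exists j, pierced f (c j) A) \/
  exists s : seq ('rV[R]_d * 'rV[R]_d),
    [/\ (size s <= g)%N, forall l, l \in s -> l.2 != 0
      & forall j i, c j i -> exists2 l, l \in s &
          A i `&` [set l.1 + t *: l.2 | t in [set: R]] !=set0].
Proof.
case: d hd => // d _; have [f [g fg]] := @flat_transversal R d.+1 d.
exists f, (d.+1 * g)%N => I A c cA coA CH.
have [|nc] := pselect (exists j, pierced f (c j) A); [by left|right].
have line (j0 : 'I_d.+1) : exists s : seq ('rV[R]_d.+1 * 'rV[R]_d.+1),
    [/\ (size s <= g)%N, forall l, l \in s -> l.2 != 0
      & forall i, c j0 i -> exists2 l, l \in s &
          A i `&` [set l.1 + t *: l.2 | t in [set: R]] !=set0].
  have [|s [sg sr sK]] := fg I A (fun j => c (lift j0 j)) cA coA.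
    by move=> j cj; apply: nc; exists (lift j0 j).
  have /choice[v vP] (e : 'rV[R]_d.+1 * 'M[R]_d.+1) : exists v : 'rV[R]_d.+1,
      v != 0 /\ (e \in s -> flat e.1 e.2 `<=` [set e.1 + t *: v | t in [set: R]]).
    have [es|es] := boolP (e \in s).
      have := sr _ es; rewrite subSnn => er.
      by have [v v0 ev] := @flat_sub_line R d.+1 e.1 e.2 isT er; exists v.
    exists (delta_mx 0 ord0); split=> //; apply/rV0Pn; exists ord0.
    by rewrite mxE !eqxx oner_neq0.
  exists [seq (e.1, v e) | e <- s]; split; first by rewrite size_map.
    by move=> l /mapP[e _ ->] /=; case: (vP e).
  move=> i ci; have [|e es [x [Ax xe]]] := sK (A i) (cA i) (coA i).
    move=> a ca; pose a' j := if unlift j0 j is Some j' then a j' else i.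
    have [|x xa] := CH a'.
      by move=> j; rewrite /a'; case: unliftP => [j' ->|->].
    exists x => [|j]; last by have := xa (lift j0 j); rewrite /a' liftK.
    by have := xa j0; rewrite /a' unlift_none.
  exists (e.1, v e); first by apply/mapP; exists e.
  by exists x; split=> //; case: (vP e) => _; apply.
have /choice[s sP] := line.
exists (flatten [seq s j | j <- enum 'I_d.+1]); split.
- rewrite -[X in (X * g)%N]size_enum_ord; apply: size_flatten_map => j.
  by case: (sP j).
- by move=> l /flatten_mapP[j _ ls]; case: (sP j) => _ + _; apply.
move=> j i cji; case: (sP j) => _ _ /(_ i cji)[l ls lA].
by exists l => //; apply/flatten_mapP; exists j => //; rewrite mem_enum.
Qed.

Lemma card_le_seq (T : eqType) (s : seq T) (n : nat) :
  (size s <= n)%N -> ([set` s] #<= `I_n)%card.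
Proof.
case: s => [|x0 s] sn.
  by rewrite (_ : [set` _] = set0) ?card_ge0 //; apply/seteqP; split.
rewrite (_ : [set` _] = nth x0 (x0 :: s) @` `I_(size (x0 :: s))).
  by apply: card_le_trans (card_image_le _ _) _; rewrite card_le_II.
apply/seteqP; split=> [x /= xs|x [i /= isz <-]]; last exact: mem_nth.
by exists (index x (x0 :: s)); [rewrite /mkset index_mem|exact: nth_index].
Qed.

(** For every subfamily with a common point choose one such point, and let [B i] be the hull of the
    points chosen for the subfamilies containing [i]. *)
Lemma compact_cores (d : nat) (I : finType) (A : I -> set 'rV[R]_d) :
  (forall i, convex_set (A i)) ->
  exists B : I -> set 'rV[R]_d,
    [/\ forall i, convex_set (B i), forall i, compact (B i),
        forall i, B i `<=` A i
      & forall S : {set I}, (exists x, forall i, i \in S -> A i x) ->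
          exists x, forall i, i \in S -> B i x].
Proof.
move=> cA; pose good (S : {set I}) := `[< exists x, forall i, i \in S -> A i x >].
have /choice[pt ptP] : forall S : {set I}, exists x,
    good S -> forall i, i \in S -> A i x.
  move=> S; have [/asboolP[x xS]|_] := boolP (good S); first by exists x.
  by exists 0.
exists (fun i => @hull R d {S : {set I} | (i \in S) && good S} (pt \o val)).
split=> [i|i|i|S Sx].
- exact: convex_hull.
- exact: compact_hull.
- apply: sub_hull => // -[S /= /andP[iS gS]]; exact: ptP.
exists (pt S) => i iS.
have gS : (i \in S) && good S by rewrite iS; apply/asboolP.
exact: (@mem_hull R d {S : {set I} | (i \in S) && good S} (pt \o val) (Sub S gS)).
Qed.

End ColorfulFamilies.

Theorem theorem7 (R : realType) (d : nat) (hd : (2 <= d)%N) :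
  exists f' g' : nat,
    forall (F : set (set 'rV[R]_d)) (C : 'I_d -> set (set 'rV[R]_d)),
      finite_set F ->
      (forall K, F K -> convex_set K) ->
      colored_by F C ->
      colorful_Helly C ->
      (exists j : 'I_d, pierced_by_points f' (C j)) \/
      crossed_by_lines g' F.
Proof.
have [f [g fg]] := @colorful_transversal R d (ltnW hd).
exists f, g => F C finF cF FC CH.
have [s sF] := (@finite_seqP {classic set 'rV[R]_d} F).1 finF.
(* Sets are addressed by indices: class [j] becomes the set of [i] with [C j (A i)], so classes may
   overlap. *)
pose A (i : 'I_(size s)) : set 'rV[R]_d := tnth (in_tuple s) i.
have FA K : F K -> exists i, K = A i.
  by rewrite sF /= => /seq_tnthP[i ->]; exists i.
have AF i : F (A i) by rewrite sF /=; exact: mem_tnth.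
have CF j K : C j K -> F K by rewrite FC => CK; exists j.
have [B [cB coB BA AB]] := compact_cores (fun i => cF _ (AF i)).
have CHB (a : 'I_d -> 'I_(size s)) : (forall j, C j (A (a j))) ->
    exists x, forall j, B (a j) x.
  move=> Ca; have [|x xa] := CH (A \o a); first exact: Ca.
  (* The cores keep a common point for the subfamily picked by [a], and so inherit the colorful
     Helly property. *)
  have [|y yB] := AB [set a j | j in 'I_d]%SET.
    by exists x => _ /finset.imsetP[j _ ->]; exact: xa.
  by exists y => j; apply: yB; exact: finset.imset_f.
have [[j [X [Xf XB]]]|[l [lg l0 lB]]] :=
    fg 'I_(size s) B (fun j i => C j (A i)) cB coB CHB.
  left; exists j, [set` X]; split; first exact: card_le_seq.
  move=> K CK; have [i Ki] := FA _ (CF _ _ CK).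
  have [|x xX Bx] := XB i; first by rewrite -Ki.
  by exists x; split=> //; rewrite Ki; exact: BA.
pose line (e : 'rV[R]_d * 'rV[R]_d) := [set e.1 + t *: e.2 | t in [set: R]].
right; exists (line @` [set` l]); split.
- by apply: card_le_trans (card_image_le _ _) _; exact: card_le_seq.
- by move=> _ [e el <-]; exists e.1, e.2; split=> //; exact: l0.
move=> K FK; have [i Ki] := FA _ FK.
have [j _ CK] : (\bigcup_(j : 'I_d) C j) K by rewrite -FC.
have [|e el [x [Bx xe]]] := lB j i; first by rewrite -Ki.
exists (line e); first by exists e.
by exists x; split=> //; rewrite Ki; exact: BA.
Qed.
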